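(* Let $\mathcal{A}$ be a unital pro-$C^*$-algebra, $\mathcal{X}$ a Hilbert $\mathcal{A}$-module, $\{\mathcal{X}_i\}_{i\in I}$ a family of Hilbert $\mathcal{A}$-modules with $I$ finite or countably infinite, $K\in Hom_{\mathcal{A}}^*(\mathcal{X})$, and $\Gamma_i\in Hom_{\mathcal{A}}^*(\mathcal{X},\mathcal{X}_i)$ for each $i\in I$. For every $i\in I$ let $\{u_{i,j}:j\in J_i\}$, $J_i\subset\mathbf{Z}$, be a standard orthonormal basis for $\mathcal{X}_i$, and set $w_{i,j}=\Gamma_i^*u_{i,j}$ for $i\in I$, $j\in J_i$. Then $\{\Gamma_i\}_{i\in I}$ is a $K$-$g$-Riesz basis for $\mathcal{X}$ with respect to $\{\mathcal{X}_i\}_{i\in I}$ if and only if $\{w_{i,j}:i\in I,j\in J_i\}$ is a $K$-Riesz basis for $\mathcal{X}$.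
   Context: A pro-$C^*$-algebra (locally $C^*$-algebra) $\mathcal{A}$ is a complete Hausdorff complex topological $*$-algebra whose topology is determined by its continuous $C^*$-seminorms; $S(\mathcal{A})$ denotes the set of these seminorms. A Hilbert $\mathcal{A}$-module $\mathcal{X}$ is a complex vector space and left $\mathcal{A}$-module with an $\mathcal{A}$-valued inner product $\langle\cdot,\cdot\rangle$ which is $\mathbb{C}$- and $\mathcal{A}$-linear in the first argument and satisfies $\langle\xi,\eta\rangle^*=\langle\eta,\xi\rangle$, $\langle\xi,\xi\rangle\ge 0$, and $\langle\xi,\xi\rangle=0$ iff $\xi=0$, and which is complete for the seminorms $\bar p_{\mathcal{X}}(\xi)=\sqrt{p(\langle\xi,\xi\rangle)}$, $p\in S(\mathcal{A})$. $Hom_{\mathcal{A}}^*(\mathcal{X},\mathcal{Y})$ is the set of adjointable operators, i.e. maps $T:\mathcal{X}\to\mathcal{Y}$ for which there is $T^*:\mathcal{Y}\to\mathcal{X}$ with $\langle T\xi,\eta\rangle=\langle\xi,T^*\eta\rangle$ for all $\xi,\eta$; $Hom_{\mathcal{A}}^*(\mathcal{X})=Hom_{\mathcal{A}}^*(\mathcal{X},\mathcal{X})$. $Ker$ denotes kernel. For a countable index set $L$, $l^2(\mathcal{A})$ is the Hilbert $\mathcal{A}$-module of families $\{\alpha_l\}_{l\in L}\subset\mathcal{A}$ such that $\sum_l\alpha_l\alpha_l^*$ converges in $\mathcal{A}$. $l^2(\{\mathcal{X}_i\}_{i\in I})$ is the Hilbert $\mathcal{A}$-module of families $\{x_i\}_{i\in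 I}$, $x_i\in\mathcal{X}_i$, such that $\sum_i\langle x_i,x_i\rangle$ converges in $\mathcal{A}$, with inner product $\sum_i\langle x_i,y_i\rangle$. A standard orthonormal basis for a Hilbert $\mathcal{A}$-module $\mathcal{Y}$ is a family $\{u_j\}_{j\in J}\subset\mathcal{Y}$ with $\langle u_j,u_k\rangle=\delta_{j,k}1_{\mathcal{A}}$ and $\langle\xi,\xi\rangle=\sum_{j}\langle\xi,u_j\rangle\langle u_j,\xi\rangle$ for all $\xi\in\mathcal{Y}$. A family $\{\xi_l\}_{l\in L}$ in $\mathcal{X}$ is a $K$-Riesz basis for $\mathcal{X}$ if (1) $\{\xi\in\mathcal{X}:\langle\xi,\xi_l\rangle=0\text{ for all }l\}\subset Ker(K^* )$, and (2) there are $C,D>0$ such that for every $\{\alpha_l\}_{l\in L}\in l^2(\mathcal{A})$, $C\sum_l\alpha_l\alpha_l^*\le\left\langle\sum_l\alpha_l\xi_l,\sum_l\alpha_l\xi_l\right\rangle\le D\sum_l\alpha_l\alpha_l^*$. $\{\Gamma_i\}_{i\in I}$ is a $K$-$g$-Riesz basis for $\mathcal{X}$ with respect to $\{\mathcal{X}_i\}_{i\in I}$ if (a) $\{\xi\in\mathcal{X}:\Gamma_i\xi=0\text{ for all }i\in I\}\subset Ker(K^* )$, and (b) there are $C,D>0$ such that for every $\{g_i\}_{i\in I}\in l^2(\{\mathcal{X}_i\}_{i\in I})$, $C\sum_{i}\langle g_i,g_i\rangle\le\left\langle\sum_i\Gamma_i^*g_i,\sum_i\Gamma_i^*g_i\right\rangle\le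 D\sum_i\langle g_i,g_i\rangle$. *)

(* Defs.v *)
From HB Require Import structures.
From mathcomp Require Import all_boot all_order all_algebra finmap complex.
From mathcomp Require Import all_classical all_reals all_analysis summability.

Set Implicit Arguments.
Unset Strict Implicit.
Unset Printing Implicit Defensive.
Import Order.TTheory GRing.Theory Num.Theory.
Import numFieldNormedType.Exports.

Local Open Scope classical_set_scope.
Local Open Scope complex_scope.
Local Open Scope ring_scope.

(* An index set such as I or J_i is countable but not ordered, so a sum over it
   is the limit of the net of its finite partial sums. *)
Definition has_sum (I : choiceType) (M : PreUniformZmodule.type)
    (f : I -> M) (s : M) :=
  partial_sum f @ totally --> s.

Definition complete_uniform (T : uniformType) :=
  forall F : set_system T, ProperFilter F -> cauchy F -> exists x : T, F --> x.

HB.mixin Record hasStar (R : realType) A & GRing.Algebra R[i] A := {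
  star : A -> A;
  starD : {morph star : a b / a + b};
  starZ : forall (k : R[i]) (a : A), star (k *: a) = k^* *: star a;
  starM : forall a b : A, star (a * b) = star b * star a;
  starK : involutive star
}.

HB.structure Definition StarTvsAlgebra (R : realType) :=
  {A of Tvs R[i] A & GRing.Algebra R[i] A & hasStar R A}.

Record cstar_seminorm (R : realType) (A : StarTvsAlgebra.type R)
    (p : A -> R) : Prop := {
  csn_ge0 : forall a, 0 <= p a;
  csnD : forall a b, p (a + b) <= p a + p b;
  csnZ : forall (k : R[i]) a, (p (k *: a))%:C = `|k| * (p a)%:C;
  csnM : forall a b, p (a * b) <= p a * p b;
  csn_star : forall a, p (star a * a) = p a ^+ 2
}.

Definition continuous_cstar_seminorm (R : realType) (A : StarTvsAlgebra.type R)
    (p : A -> R) :=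
  cstar_seminorm p /\ continuous p.

(* The maximum of two continuous C*-seminorms is again one, so single seminorms
   give a base of the uniformity, not merely a subbase. *)
HB.mixin Record isProCStar (R : realType) A & StarTvsAlgebra R A := {
  mul_continuous : continuous (fun x : A * A => x.1 * x.2);
  star_continuous : continuous (star : A -> A);
  procstar_hausdorff : hausdorff_space A;
  procstar_complete : complete_uniform A;
  procstar_entourage : forall E : set (A * A), entourage E <->
    exists p : A -> R, exists2 e : R,
      continuous_cstar_seminorm p /\ 0 < e
      & [set x | p (x.1 - x.2) < e] `<=` E
}.

#[short(type="proCStarType")]
HB.structure Definition ProCStar (R : realType) :=
  {A of StarTvsAlgebra R A & isProCStar R A}.

Section Positivity.
Context (R : realType) (A : proCStarType R).
Implicit Types a b : A.

Definition invertible a := exists b, a * b = 1 /\ b * a = 1.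

Definition spectrum a : set R[i] := [set z | ~ invertible (z%:A - a)].

(* In R[i], 0 <= z means that z is real and nonnegative. *)
Definition positive a := star a = a /\ spectrum a `<=` [set z | 0 <= z].

Definition ple a b := positive (b - a).

End Positivity.

Notation "a <=p b" := (ple a b) (at level 70, no associativity) : ring_scope.

(* The two scalar actions are automatically compatible: a difference such as
   k *: x - act k%:A x has zero inner product with every vector. *)
HB.mixin Record isHilbertModule (R : realType) (A : proCStarType R) X
    & PreUniformLmodule R[i] X := {
  act : A -> X -> X;
  actDl : forall (a b : A) (x : X), act (a + b) x = act a x + act b x;
  actDr : forall (a : A) (x y : X), act a (x + y) = act a x + act a y;
  actM : forall (a b : A) (x : X), act (a * b) x = act a (act b x);
  act1 : forall x : X, act 1 x = x;
  inner : X -> X -> A;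
  innerDl : forall x y z : X, inner (x + y) z = inner x z + inner y z;
  innerZl : forall (k : R[i]) (x y : X), inner (k *: x) y = k *: inner x y;
  inner_act : forall (a : A) (x y : X), inner (act a x) y = a * inner x y;
  inner_star : forall x y : X, star (inner x y) = inner y x;
  inner_ge0 : forall x : X, 0 <=p inner x x;
  inner_eq0 : forall x : X, inner x x = 0 <-> x = 0;
  hilbert_complete : complete_uniform X;
  hilbert_entourage : forall E : set (X * X), entourage E <->
    exists p : A -> R, exists2 e : R,
      continuous_cstar_seminorm p /\ 0 < e
      & [set x | Num.sqrt (p (inner (x.1 - x.2) (x.1 - x.2))) < e] `<=` E
}.

#[short(type="hilbertModType")]
HB.structure Definition HilbertModule (R : realType) (A : proCStarType R) :=
  {X of PreUniformLmodule R[i] X & isHilbertModule R A X}.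

Notation "a **: x" := (act a x) (at level 40) : ring_scope.
Notation "'<|' x , y '|>'" := (inner x y)
  (at level 0, x at level 69, y at level 69, format "'<|' x ,  y '|>'") : ring_scope.

Section Bases.
Context (R : realType) (A : proCStarType R).

(* The adjoint is unique, so carrying it amounts to asserting its existence. *)
Record adjointable (X Y : hilbertModType A) := Adjointable {
  hom_fun :> X -> Y;
  adjoint : Y -> X;
  adjointP : forall x y, <| hom_fun x, y |> = <| x, adjoint y |>
}.

Definition standard_orthonormal_basis (J : countType) (Y : hilbertModType A)
    (u : J -> Y) :=
  (forall j k, <| u j, u k |> = if j == k then 1 else 0) /\
  (forall y : Y, has_sum (fun j => <| y, u j |> * <| u j, y |>) <| y, y |>).

Definition l2 (L : countType) : set (L -> A) :=
  [set a | exists t, has_sum (fun l => a l * star (a l)) t].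

Definition l2_direct_sum (I : countType) (X_ : I -> hilbertModType A)
  : set (forall i, X_ i) :=
  [set g | exists t, has_sum (fun i => <| g i, g i |>) t].

Definition K_Riesz_basis (X : hilbertModType A) (K : adjointable X X)
    (L : countType) (xi : L -> X) :=
  [set x : X | forall l, <| x, xi l |> = 0] `<=` [set x | adjoint K x = 0] /\
  exists C D : R, [/\ 0 < C, 0 < D & forall a : L -> A, l2 a ->
    exists (t : A) (s : X),
      [/\ has_sum (fun l => a l * star (a l)) t,
          has_sum (fun l => a l **: xi l) s,
          C%:C *: t <=p <| s, s |> & <| s, s |> <=p D%:C *: t]].

Definition K_g_Riesz_basis (X : hilbertModType A) (K : adjointable X X)
    (I : countType) (X_ : I -> hilbertModType A)
    (Gamma : forall i, adjointable X (X_ i)) :=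
  [set x : X | forall i, Gamma i x = 0] `<=` [set x | adjoint K x = 0] /\
  exists C D : R, [/\ 0 < C, 0 < D & forall g : (forall i, X_ i), l2_direct_sum g ->
    exists (t : A) (s : X),
      [/\ has_sum (fun i => <| g i, g i |>) t,
          has_sum (fun i => adjoint (Gamma i) (g i)) s,
          C%:C *: t <=p <| s, s |> & <| s, s |> <=p D%:C *: t]].

End Bases.

(* Main.v *)
Require Import Defs.
From mathcomp Require Import all_boot all_order all_algebra.
From mathcomp Require Import all_classical all_reals all_analysis.
From HB Require Import structures.
From mathcomp Require Import finmap complex summability ring lra.

Set Implicit Arguments.
Unset Strict Implicit.
Unset Printing Implicit Defensive.

(* With [a i j = <|g i, u i j|>], the maps [g |-> a] and [a |-> g] identify
   [l2(X_i)] with [l2(A)] over the disjoint union of the [J i], preserving the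
   squared norms, and [sum_i Gamma_i^* g_i = sum_(i,j) a_ij w_ij].  The existence
   of each regrouped sum is a Cauchy argument: in one direction the upper Riesz
   bound is applied to finitely supported families, in the other the tails of
   [sum a_ij a_ij^*] are dominated by those of [sum_i <|g i, g i|>].  That the
   regrouped sums agree is checked fibrewise, weakly, so the continuity of
   adjoints is never used.

   Domination needs [0 <= a <= b -> p a <= c p b] for every C*-seminorm [p].
   With the constant [c = 3] it has an elementary proof from the C*-identity,
   and parallelogram and polarization identities then give a triangle inequality
   and a Cauchy-Schwarz inequality up to constants, which is enough for all
   convergence questions. *)

(** * Seminorms on a commutative ring with a C*-identity for squares *)

Section SquareNorm.
Import Order.TTheory GRing.Theory Num.Theory.
Local Open Scope ring_scope.
Context (R : realType) (B : comNzRingType) (N : B -> R).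

(** The model is a C*-seminorm on the real polynomials in one self-adjoint element, where [sqn_sqr]
    is the C*-identity. *)
Record square_norm : Prop := {
  sqn_ge0 : forall x, 0 <= N x;
  sqnD : forall x y, N (x + y) <= N x + N y;
  sqnN : forall x, N (- x) = N x;
  sqn_mul2 : forall x, N (x *+ 2) = 2 * N x;
  sqnM : forall x y, N (x * y) <= N x * N y;
  sqn_sqr : forall x, N (x ^+ 2) = N x ^+ 2;
  sqn_mono : forall x y, N (x ^+ 2) <= N (x ^+ 2 + y ^+ 2)
}.

Context (HN : square_norm).

Lemma sqn_le_of_sqr x y z : x ^+ 2 = y ^+ 2 + z ^+ 2 -> N y <= N x.
Proof.
move=> e; rewrite -(@ler_pXn2r _ 2) ?nnegrE ?sqn_ge0//.
by rewrite -!sqn_sqr // e sqn_mono.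
Qed.

Lemma sqn_mul2_le x y z : x ^+ 2 = (y *+ 2) ^+ 2 + z ^+ 2 -> 2 * N y <= N x.
Proof. by move=> /sqn_le_of_sqr; rewrite sqn_mul2. Qed.

(** The geometric sum [1 + q + ... + q ^ (2 ^ k - 1)], factored into the [1 + q ^ (2 ^ m)] so that
    each factor can be estimated separately. *)
Fixpoint geom_prod k (q : B) : B :=
  if k is k'.+1 then (1 + q) * geom_prod k' (q ^+ 2) else 1.

Lemma geom_prodE k q : (1 - q) * geom_prod k q = 1 - q ^+ (2 ^ k).
Proof.
elim: k q => [|k IH] q /=; first by rewrite mulr1 expn0 expr1.
rewrite mulrA (_ : (1 - q) * (1 + q) = 1 - q ^+ 2); last by ring.
by rewrite IH -exprM -expnS.
Qed.

(** Since [(1 + h ^ 2) ^ 2 = (2 h) ^ 2 + (1 - h ^ 2) ^ 2], a factor [1 + h ^ 2] has at least twice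
    the effect of [h]. The multiplier [z] absorbs the first factor in the induction. *)
Lemma sqn_geom_prod_ge k h z :
  2 ^+ k * N (h ^+ (2 ^ k - 1) * z) <= N (geom_prod k (h ^+ 2) * z).
Proof.
elim: k h z => [|k IH] h z /=; first by rewrite expr0 mul1r.
rewrite [(1 + _) * _]mulrC -mulrA.
apply: le_trans (IH _ _).
rewrite exprSr -mulrA ler_pM2l ?exprn_gt0//.
have -> : (2 ^ k.+1 - 1 = (2 * (2 ^ k - 1)).+1)%N.
  by rewrite expnS; case: (2 ^ k)%N (expn_gt0 2 k) => // n _; rewrite mulnS !subn1.
set c := (h ^+ 2) ^+ _; rewrite exprS exprM -/c.
by apply: (@sqn_mul2_le _ _ (c * ((1 - h ^+ 2) * z))); ring.
Qed.

(* Norm-one [g] with [1 - g] of norm at most one has [1] in its spectrum: if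
   [1 - g] were invertible, the elements [r] would be bounded by twice the norm
   of its inverse. *)
Lemma sqn_unbounded g k : N 1 <= 1 -> N g = 1 -> N (1 - g) <= 1 ->
  exists r, 2 ^+ k <= N r /\ N (r * (1 - g)) <= 2.
Proof.
move=> N1 Ng N1g; have NX n : N (g ^+ n) <= 1.
  elim: n => [|n IH]; first by rewrite expr0.
  by rewrite exprS (le_trans (sqnM HN _ _))// Ng mul1r.
(* Repeated squaring gives [N (g ^ (2 ^ k)) = 1], which forces [1 <= N (g ^ (2 ^ k - 1))]. *)
have NP : 2 ^+ k <= N (geom_prod k (g ^+ 2)).
  have := sqn_geom_prod_ge k g 1; rewrite !mulr1; apply: le_trans.
  rewrite ler_peMr ?exprn_ge0//.
  have NXk : N (g ^+ (2 ^ k)) = 1.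
    by elim: {NX} k => [|k IH]; rewrite ?expr1// expnSr exprM sqn_sqr// IH expr1n.
  rewrite -[X in X <= _]NXk -[X in g ^+ X](@subnK 1) ?expn_gt0//.
  by rewrite exprD (le_trans (sqnM HN _ _))// expr1 Ng mulr1.
(* The sum of the [g ^ n] for [n < 2 ^ k.+1], which telescopes against [1 - g]. *)
exists ((1 + g) * geom_prod k (g ^+ 2)); split.
  set P := geom_prod _ _ in NP *.
  have : N (P *+ 2) <= N ((1 + g) * P) + N (1 - g) * N P.
    rewrite (_ : P *+ 2 = (1 + g) * P + (1 - g) * P); last by ring.
    by rewrite (le_trans (sqnD HN _ _))// lerD2l sqnM.
  have : N (1 - g) * N P <= N P by rewrite ler_piMl ?sqn_ge0.
  by rewrite sqn_mul2//; lra.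
have -> : (1 + g) * geom_prod k (g ^+ 2) * (1 - g) = 1 - g ^+ (2 ^ k.+1).
  by rewrite -geom_prodE /=; ring.
by rewrite (le_trans (sqnD HN _ _))// sqnN// (_ : 2 = 1 + 1 :> R)// lerD.
Qed.

End SquareNorm.

(** * The involution and real polynomials in a self-adjoint element *)

Section CstarSeminorm.
Import Order.TTheory GRing.Theory Num.Theory.
Local Open Scope complex_scope.
Local Open Scope ring_scope.
Context (R : realType) (A : StarTvsAlgebra.type R).
Implicit Types (a b g : A) (r : R).

Lemma star0 : star (0 : A) = 0.
Proof. by apply: (@addrI _ (star 0)); rewrite -starD !addr0. Qed.

Lemma starN a : star (- a) = - star a.
Proof. by apply: (@addrI _ (star a)); rewrite -starD !subrr star0. Qed.

HB.instance Definition _ := GRing.isZmodMorphism.Build A A (@star R A)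
  (fun a b => etrans (starD a (- b)) (congr1 _ (starN b))).

Lemma star1 : star (1 : A) = 1.
Proof. by rewrite -[LHS]mulr1 -[X in _ * X](starK 1) -starM mulr1 starK. Qed.

Lemma starZr r a : star (r%:C *: a) = r%:C *: star a.
Proof. by rewrite starZ conj_Creal ?complex_real. Qed.

(** Real coefficients keep the values self-adjoint when [g] is, and values at the same [g]
    commute. *)
Definition real_horner g : {poly R} -> A :=
  horner_alg g \o map_poly (real_complex R).
HB.instance Definition _ g := GRing.RMorphism.on (real_horner g).

Lemma real_hornerX g : real_horner g 'X = g.
Proof. by rewrite /real_horner /= map_polyX horner_algX. Qed.

Lemma real_hornerC g r : real_horner g r%:P = r%:C%:A.
Proof. by rewrite /real_horner /= map_polyC horner_algC. Qed.

Lemma star_real_horner g P : star g = g -> star (real_horner g P) = real_horner g P.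
Proof.
move=> gs; elim/poly_ind: P => [|P r IH]; first by rewrite !raddf0.
rewrite !rmorphD rmorphM raddfD /= real_hornerX real_hornerC starM starZr star1 IH gs.
congr (_ + _); rewrite -[X in X * _](real_hornerX g) -[X in _ = _ * X](real_hornerX g).
by rewrite -!rmorphM mulrC.
Qed.

End CstarSeminorm.

(** * Positivity and domination for a single C*-seminorm *)

Section CstarSeminormOrder.
Import Order.TTheory GRing.Theory Num.Theory.
Local Open Scope complex_scope.
Local Open Scope ring_scope.
Context (R : realType) (A : StarTvsAlgebra.type R) (p : A -> R).
Hypothesis hp : cstar_seminorm p.
Implicit Types (a b c g : A) (r : R).

Lemma csnZr r a : 0 <= r -> p (r%:C *: a) = r * p a.
Proof.
move=> r0; apply: complexI; rewrite (csnZ hp) ger0_norm ?ler0c//.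
by rewrite -rmorphM.
Qed.

Lemma csnN a : p (- a) = p a.
Proof.
apply: complexI; rewrite -scaleN1r (csnZ hp) normrN normr1.
by rewrite mul1r.
Qed.

Lemma csn0 : p 0 = 0.
Proof. by have := csnZr 0 (lexx 0); rewrite scaler0 mul0r. Qed.

Lemma csnB a b : p (a - b) <= p a + p b.
Proof. by rewrite -(csnN b) csnD. Qed.

Lemma csn1_le1 : p 1 <= 1.
Proof.
have := csn_star hp 1; rewrite star1 mulr1 => e.
have : p 1 * (p 1 - 1) = 0 by rewrite mulrBr mulr1 -expr2 -e subrr.
by move=> /eqP; rewrite mulf_eq0 subr_eq0 => /orP[]/eqP ->.
Qed.

Lemma csn_scalar_le r : 0 <= r -> p r%:C%:A <= r.
Proof. by move=> r0; rewrite csnZr// ler_piMr// csn1_le1. Qed.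

Lemma csnX a n : p (a ^+ n) <= p a ^+ n.
Proof.
elim: n => [|n IH]; first by rewrite !expr0 csn1_le1.
by rewrite !exprS (le_trans (csnM hp _ _))// ler_wpM2l ?(csn_ge0 hp).
Qed.

Lemma csn_starE a : p (star a) = p a.
Proof.
have le b : p b <= p (star b).
  have [->|pb] := eqVneq (p b) 0; first exact: csn_ge0.
  have {}pb : 0 < p b by rewrite lt_neqAle eq_sym pb (csn_ge0 hp).
  by rewrite -(ler_pM2r pb) -expr2 -(csn_star hp) (csnM hp).
by apply/eqP; rewrite eq_le le andbT -[X in _ <= p X]starK.
Qed.

Lemma csn_sqr a : star a = a -> p (a ^+ 2) = p a ^+ 2.
Proof. by move=> e; rewrite -(csn_star hp) e expr2. Qed.

(** With [c = a + i b], commutation gives [a ^ 2 + b ^ 2 = star c * c], and [a] is the mean of [c]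
    and [star c], which have the same seminorm. *)
Lemma csn_mono_sqr a b : star a = a -> star b = b -> a * b = b * a ->
  p (a ^+ 2) <= p (a ^+ 2 + b ^+ 2).
Proof.
move=> sa sb ab; set i : R[i] := 0 +i* 1.
have si : star (i *: b) = - (i *: b).
  rewrite starZ sb -scaleNr; congr (_ *: _).
  by apply/eqP; rewrite eq_complex /= !oppr0 !eqxx.
have ii : i * i = -1 by apply/eqP; rewrite eq_complex /= ; apply/andP; split; apply/eqP; ring.
have -> : a ^+ 2 + b ^+ 2 = star (a + i *: b) * (a + i *: b).
  rewrite starD sa si mulrDl !mulrDr !mulNr -!scalerAl -!scalerAr scalerA ii.
  by rewrite scaleN1r opprK -ab addrA addrK.
rewrite (csn_sqr sa) (csn_star hp) ler_pXn2r ?nnegrE ?(csn_ge0 hp)//.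
rewrite -(@ler_pM2l _ 2)// -csnZr// mulr_natl mulr2n -[X in _ <= X + _]csn_starE.
apply: le_trans (csnD hp _ _); rewrite le_eqVlt; apply/orP; left; apply/eqP; congr p.
rewrite starD sa si addrACA addNr addr0 (_ : 2%:C = 2) ?scaler_nat//.
by rewrite rmorph_nat.
Qed.

Lemma square_norm_horner g : star g = g -> square_norm (p \o real_horner g).
Proof.
move=> sg; split => /=.
- by move=> P; exact: csn_ge0.
- by move=> P Q; rewrite rmorphD csnD.
- by move=> P; rewrite rmorphN csnN.
- move=> P; rewrite raddfMn -scaler_nat -csnZr//; congr (p (_ *: _)).
  by rewrite rmorph_nat.
- by move=> P Q; rewrite rmorphM csnM.
- by move=> P; rewrite rmorphXn csn_sqr// star_real_horner.
- move=> P Q; rewrite rmorphD !rmorphXn csn_mono_sqr ?star_real_horner//.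
  by rewrite -!rmorphM mulrC.
Qed.

(* Positivity of [a] in the C*-algebra completing [A] for [p]. *)
Definition csn_pos a := star a = a /\ forall r, p a <= r -> p (r%:C%:A - a) <= r.

(* Right invertibility of [a] in the completion of [A] for [p]. *)
Definition csn_quasi_unit a := exists b, p (1 - a * b) <= 2^-1.

Lemma unbounded_pow2 r : exists k, r < 2 ^+ k.
Proof.
exists (Num.bound r); have [r0|r0] := leP r 0.
  by rewrite (le_lt_trans r0)// exprn_gt0.
rewrite (lt_le_trans (archi_boundP (ltW r0)))// -natrX ler_nat.
by rewrite ltnW// ltn_expl.
Qed.

(** If [m = p (r - a)] exceeded [r], then [g = (r - a) / m] would have norm one, while
    [1 - g = (a + (m - r)) / m] would be a quasi unit of norm at most one. *)
Lemma csn_pos_quasi_unit a : star a = a ->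
  (forall e, 0 < e -> csn_quasi_unit (a + e%:C%:A)) -> csn_pos a.
Proof.
move=> sa ha; split=> // r par; rewrite leNgt; apply/negP.
set y := _ - a; set m := p y => rm.
have pa0 := csn_ge0 hp a.
have m0 : 0 < m by exact: le_lt_trans (le_trans pa0 par) rm.
have mi0 : 0 <= m^-1 by rewrite invr_ge0 ltW.
pose g := (m^-1)%:C *: y.
have sg : star g = g by rewrite /g starZr raddfB /= starZr star1 sa.
have mK : m%:C * (m^-1)%:C = 1 :> R[i] by rewrite -rmorphM mulfV ?gt_eqF// rmorph1.
have g1 : 1 - g = (m^-1)%:C *: (a + (m - r)%:C%:A).
  rewrite -{1}[1]scale1r -{1}mK mulrC -scalerA -scalerBr; congr (_ *: _).
  by rewrite /y opprB rmorphB scalerBl addrCA.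
have [w hw] : csn_quasi_unit (1 - g).
  have [|w hw] := ha (m - r); first by rewrite subr_gt0.
  exists (m%:C *: w); rewrite g1 -scalerAl -scalerAr scalerA mulrC.
  by rewrite [m%:C * _]mK scale1r.
(* The bound [p Q <= p Q / 2 + 2 * p w] reached below means [p Q <= 4 * p w], which [2 ^ k <= p Q]
   then contradicts. *)
have [k hk] := unbounded_pow2 (4 * p w).
(* [y / p y] would violate [sqn_unbounded], since [p y - y] is invertible. *)
have [||| P []] := sqn_unbounded (square_norm_horner sg) (g := 'X) k.
- by rewrite /= rmorph1 csn1_le1.
- by rewrite /= real_hornerX csnZr// mulVf ?gt_eqF.
- rewrite /= rmorphB rmorph1 /= real_hornerX g1 csnZr//.
  rewrite ler_pdivrMl// mulr1 (le_trans (csnD hp _ _))//.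
  by have := @csn_scalar_le (m - r); rewrite subr_ge0 ltW// => /(_ isT); lra.
rewrite /= rmorphM rmorphB rmorph1 /= real_hornerX.
set Q := real_horner g P => Qk Qg.
have : p Q <= p Q * 2^-1 + 2 * p w.
  rewrite -[X in p X <= _](mulr1 Q) -[X in Q * X](subrK ((1 - g) * w)) mulrDr.
  rewrite (le_trans (csnD hp _ _))// lerD//.
    by rewrite (le_trans (csnM hp _ _))// ler_wpM2l ?(csn_ge0 hp).
  by rewrite mulrA (le_trans (csnM hp _ _))// ler_wpM2r ?(csn_ge0 hp).
lra.
Qed.

(** A Neumann series for [1 - x] with [x = a / (r + e)], truncated once [p x ^ n] is at most one
    half. *)
Lemma csn_quasi_unit_sub r e a : 0 < e -> p a <= r ->
  csn_quasi_unit ((r + e)%:C%:A - a).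
Proof.
move=> e0 par; have pa0 := csn_ge0 hp a.
have re0 : 0 < r + e by lra.
have reK : ((r + e)^-1)%:C * (r + e)%:C = 1 :> R[i].
  by rewrite -rmorphM mulVf ?gt_eqF// rmorph1.
pose x := ((r + e)^-1)%:C *: a.
have px : p x < 1 by rewrite csnZr ?invr_ge0 ?(ltW re0)// ltr_pdivrMl//; lra.
have [n hn] : exists n, p x ^+ n <= 2^-1.
  have := @cvg_expr R (p x); rewrite ger0_norm ?(csn_ge0 hp)// => /(_ px).
  move=> /cvgrPdist_le /(_ 2^-1); rewrite invr_gt0 ltr0n => /(_ isT) [n _ /(_ n)].
  rewrite /= leqnn => /(_ isT); rewrite sub0r normrN.
  by rewrite ger0_norm ?exprn_ge0 ?(csn_ge0 hp)// => ?; exists n.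
exists (((r + e)^-1)%:C *: \sum_(i < n) x ^+ i).
rewrite -scalerAr scalerAl scalerBr scalerA reK scale1r -/x.
have -> : (1 - x) * \sum_(i < n) x ^+ i = 1 - x ^+ n.
  by rewrite -[1 - x]opprB mulNr -subrX1 opprB.
by rewrite subKr (le_trans (csnX _ _)).
Qed.

(** [a + b + e] is the scalar [p a + p b + e] minus [(p a - a) + (p b - b)], whose seminorm is at
    most [p a + p b] by positivity. *)
Lemma csn_posD a b : csn_pos a -> csn_pos b -> csn_pos (a + b).
Proof.
move=> [sa ha] [sb hb]; apply: csn_pos_quasi_unit; first by rewrite starD sa sb.
move=> e e0; have -> : a + b + e%:C%:A =
    (p a + p b + e)%:C%:A - ((p a)%:C%:A - a + ((p b)%:C%:A - b)).
  rewrite !rmorphD !scalerDl.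
  by rewrite [_ - a + _]addrACA -opprD opprB [RHS]addrC addrA subrK.
apply: csn_quasi_unit_sub => //.
by rewrite (le_trans (csnD hp _ _))// lerD ?ha ?hb.
Qed.

Lemma csn_pos0 : csn_pos 0.
Proof. by split=> [|r]; rewrite ?star0// csn0 subr0 => /csn_scalar_le. Qed.

Lemma csn_pos_sum (I : Type) (s : seq I) (P : pred I) (f : I -> A) :
  (forall i, P i -> csn_pos (f i)) -> csn_pos (\sum_(i <- s | P i) f i).
Proof. by move=> hf; elim/big_ind: _ => //; [exact: csn_pos0 | exact: csn_posD]. Qed.

(** Two identities squeeze [p (r ^ 2 + a ^ 2)]: its square is [(2 r a) ^ 2 + (r ^ 2 - a ^ 2) ^ 2],
    giving a lower bound, and its double is [(r + a) ^ 2 + (r - a) ^ 2], which positivity of [a] and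
    [b] bounds above. *)
Lemma csn_le_add a b : csn_pos a -> csn_pos b -> p a <= 3 * p (a + b).
Proof.
move=> [sa ha] [sb hb]; have pa0 := csn_ge0 hp a; have pb0 := csn_ge0 hp b.
set t := p (a + b); have t0 : 0 <= t := csn_ge0 hp _.
pose r := p a + t.
have r0 : 0 <= r by rewrite addr_ge0.
have pbr : p b <= r.
  by rewrite -[b](addKr a) (le_trans (csnD hp _ _))// csnN.
have h1 : p (r%:C%:A - a) <= r by rewrite ha// lerDl.
have h2 : p (r%:C%:A + a) <= r + t.
  rewrite -[a in X in X <= _](addrK b) -/t [a + b - b]addrC addrA.
  by rewrite (le_trans (csnD hp _ _))// lerD2r hb.
have := square_norm_horner sa => /sqn_mul2_le.
pose c : {poly R} := r%:P.
move=> /(_ (c ^+ 2 + 'X ^+ 2) (c * 'X) (c ^+ 2 - 'X ^+ 2)) /=.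
have -> : (c ^+ 2 + 'X^2) ^+ 2 = (c * 'X *+ 2) ^+ 2 + (c ^+ 2 - 'X^2) ^+ 2 by ring.
move=> /(_ erefl); rewrite rmorphM /= real_hornerX real_hornerC -scalerAl mul1r csnZr// => h3.
have h4 : 2 * p (real_horner a (c ^+ 2 + 'X^2)) <= (r + t) ^+ 2 + r ^+ 2.
  have := sqn_mul2 (square_norm_horner sa) (c ^+ 2 + 'X^2) => /= <-.
  have -> : (c ^+ 2 + 'X^2) *+ 2 = (c + 'X) ^+ 2 + (c - 'X) ^+ 2 by ring.
  rewrite rmorphD !rmorphXn rmorphD rmorphB /= real_hornerX real_hornerC.
  apply: le_trans (csnD hp _ _) _; apply: lerD; apply: le_trans (csnX _ _) _.
    by rewrite ler_pXn2r ?nnegrE ?(csn_ge0 hp) ?addr_ge0// addrC.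
  by rewrite ler_pXn2r ?nnegrE ?(csn_ge0 hp).
(* [h3] and [h4] combine to [4 r (r - t) <= (r + t) ^ 2 + r ^ 2], which fails when [r > 4 t], that
   is, when [p a > 3 t]. *)
rewrite leNgt; apply/negP => h.
have r4 : 0 < r - 4 * t by rewrite /r; lra.
have e : p a = r - t by rewrite /r addrK.
have : 0 <= r * (2 * r - 8 * t) by apply: mulr_ge0; lra.
have : 0 < r * (r - 4 * t) by apply: mulr_gt0; lra.
have : 0 <= t * (r - 4 * t) by apply: mulr_ge0; lra.
move: h3 h4; rewrite e; clear -t0; nra.
Qed.

End CstarSeminormOrder.

(** * From spectral positivity to seminorm estimates *)

Section Positive.
Import Order.TTheory GRing.Theory Num.Theory.
Local Open Scope complex_scope.
Local Open Scope classical_set_scope.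
Local Open Scope ring_scope.
Context (R : realType) (A : proCStarType R) (p : A -> R).
Hypothesis hp : cstar_seminorm p.

(** As [- e] lies outside the spectrum, [a + e] has an exact inverse. *)
Lemma positive_csn_pos (a : A) : positive a -> csn_pos p a.
Proof.
move=> [sa ha]; apply: csn_pos_quasi_unit => // e e0.
have [b [hb _]] : invertible ((- e)%:C%:A - a).
  apply: contrapT => /(ha (- e)%:C); rewrite /= ler0c oppr_ge0 leNgt.
  by rewrite e0.
exists (- b); have -> : a + e%:C%:A = - ((- e)%:C%:A - a).
  by rewrite opprB rmorphN scaleNr opprK.
by rewrite mulrNN hb subrr csn0 ?invr_ge0.
Qed.

Lemma ple_csn_le (a b : A) : positive a -> a <=p b -> p a <= 3 * p b.
Proof.
move=> /positive_csn_pos ha /positive_csn_pos hb.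
by rewrite -[b](subrK a) addrC csn_le_add.
Qed.

End Positive.

(** * Unordered sums in complete gauged spaces *)

Section GaugedSums.
Import Order.TTheory GRing.Theory Num.Theory.
Local Open Scope classical_set_scope.
Local Open Scope ring_scope.
Context (R : realType).

(* A common setting for the seminorms [p] of [A] and the gauges
   [x |-> p <|x, x|>] of a Hilbert module: the latter are only shown to satisfy
   the triangle inequality up to the factor [6]. *)
Record gauged (V : PreUniformZmodule.type) (G : set (V -> R)) : Prop := {
  gauge_ge0 : forall N, G N -> forall x, 0 <= N x;
  gauge0 : forall N, G N -> N 0 = 0;
  gaugeN : forall N, G N -> forall x, N (- x) = N x;
  gaugeD : forall N, G N -> forall x y, N (x + y) <= 6 * (N x + N y);
  gauge_eq0 : forall x, (forall N, G N -> N x = 0) -> x = 0;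
  gauge_entourage : forall E : set (V * V), entourage E <->
    exists N e, [/\ G N, 0 < e & [set x | N (x.1 - x.2) < e] `<=` E];
  gauge_complete : complete_uniform V
}.

Lemma eq0_of_small (r c : R) : 0 <= r -> 0 < c ->
  (forall e, 0 < e -> r <= c * e) -> r = 0.
Proof.
move=> r0 c0 h; apply/eqP; rewrite eq_le r0 andbT leNgt; apply/negP => r1.
have := h (r / (c * 2)); rewrite divr_gt0 ?mulr_gt0// => /(_ isT).
have -> : c * (r / (c * 2)) = r / 2 by field; rewrite gt_eqF.
lra.
Qed.

Section OneSpace.
Context (V : PreUniformZmodule.type) (G : set (V -> R)) (hG : gauged G).

Lemma gaugeB N : G N -> forall x y, N (x - y) <= 6 * (N x + N y).
Proof. by move=> GN x y; rewrite -(gaugeN hG GN y) (gaugeD hG GN). Qed.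

Section OneIndex.
Context (L : choiceType).
Implicit Types (f g : L -> V) (F : {fset L}).

Lemma has_sumP f s : has_sum f s <-> forall N, G N -> forall e, 0 < e ->
  exists F0 : {fset L}, forall F, (F0 `<=` F)%fset -> N (\sum_(l <- F) f l - s) < e.
Proof.
have FF := @totally_filter L.
split=> [/cvg_entourageP h N GN e e0|h].
  have /h[F0 _ hF0] : entourage [set x : V * V | N (x.1 - x.2) < e].
    by apply/(gauge_entourage hG); exists N, e; split.
  exists F0 => F /hF0 /=; rewrite /partial_sum big_seq_fsetE /=.
  by rewrite -(gaugeN hG GN) opprB.
apply/cvg_entourageP => E /(gauge_entourage hG)[N [e [GN e0 hE]]].
have [F0 hF0] := h N GN e e0; exists F0 => // F /hF0 hF; apply: hE => /=.
by rewrite -(gaugeN hG GN) opprB /partial_sum -(big_seq_fsetE _ _ xpredT f).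
Qed.

(** Testing finite sets disjoint from [F0], rather than differences of partial sums, lets the
    condition pass to subfamilies. *)
Definition cauchy_sum f := forall N, G N -> forall e, 0 < e ->
  exists F0 : {fset L}, forall F, (forall l, l \in F -> l \notin F0) ->
  N (\sum_(l <- F) f l) < e.

Lemma big_fsetU_disj f F F' : (forall l, l \in F -> l \notin F') ->
  \sum_(l <- (F' `|` F)%fset) f l = \sum_(l <- F') f l + \sum_(l <- F) f l.
Proof.
move=> FF'; rewrite (big_fsetID _ [in F']); congr (_ + _); apply: eq_fbigl => l; rewrite !inE.
  by case: (l \in F'); rewrite ?andbF.
by have := FF' l; case: (l \in F); case: (l \in F') => //= /(_ isT).
Qed.

Lemma has_sum_unique f s t : has_sum f s -> has_sum f t -> s = t.
Proof.
move=> /has_sumP hs /has_sumP ht; apply/eqP; rewrite -subr_eq0; apply/eqP.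
apply: (gauge_eq0 hG) => N GN.
apply: (@eq0_of_small _ 12) => //; first exact: (gauge_ge0 hG).
move=> e e0; have [F1 h1] := hs N GN e e0; have [F2 h2] := ht N GN e e0.
have {h1} := h1 (F1 `|` F2)%fset (fsubsetUl _ _).
have {h2} := h2 (F1 `|` F2)%fset (fsubsetUr _ _).
set S := \sum_(_ <- _) _ => h2 h1.
have -> : s - t = (S - t) - (S - s).
  by rewrite opprB addrCA [S - t]addrC addrK.
by have := gaugeB GN (S - t) (S - s); lra.
Qed.

Lemma has_sum_cauchy f s : has_sum f s -> cauchy_sum f.
Proof.
move=> /has_sumP hs N GN e e0.
(* By [gaugeB] a difference of two errors costs [6 * (e / 24 + e / 24) = e / 2]. *)
have [|F0 h] := hs N GN (e / 24); first by rewrite divr_gt0.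
exists F0 => F FF0; have h1 := h _ (fsubset_refl F0).
have := h (F0 `|` F)%fset (fsubsetUl _ _); rewrite big_fsetU_disj// => h2.
have := gaugeB GN (\sum_(l <- F0) f l + \sum_(l <- F) f l - s) (\sum_(l <- F0) f l - s).
rewrite opprB addrA subrK addrAC subrr add0r; lra.
Qed.

Lemma cauchy_has_sum f : cauchy_sum f -> exists s, has_sum f s.
Proof.
move=> hf; have FF := @totally_filter L.
apply: (gauge_complete hG) => E /(gauge_entourage hG)[N [e [GN e0 hE]]].
have [|F0 h] := hf N GN (e / 24); first by rewrite divr_gt0.
pose P := [set x : V | N (x - \sum_(l <- F0) f l) < e / 24].
have FP : (partial_sum f @ totally) P.
  exists F0 => // F /= F0F; rewrite /P /= /partial_sum -(big_seq_fsetE _ _ xpredT f).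
  have -> : F = (F0 `|` (F `\` F0))%fset.
    by apply/fsetP => l; rewrite !inE; case: (boolP (l \in F0)) => //= /(fsubsetP F0F).
  rewrite big_fsetU_disj; last by move=> l; rewrite inE => /andP[].
  by rewrite addrC addKr h// => l; rewrite inE => /andP[].
exists (P, P); first by split.
move=> [x y] [/= hx hy]; apply: hE => /=.
have := gaugeB GN (x - \sum_(l <- F0) f l) (y - \sum_(l <- F0) f l).
rewrite opprB addrA subrK /P /= in hx hy *; lra.
Qed.

Lemma has_sumD f g s t :
  has_sum f s -> has_sum g t -> has_sum (fun l => f l + g l) (s + t).
Proof.
move=> /has_sumP hs /has_sumP ht; apply/has_sumP => N GN e e0.
have [|F1 h1] := hs N GN (e / 12); first by rewrite divr_gt0.
have [|F2 h2] := ht N GN (e / 12); first by rewrite divr_gt0.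
exists (F1 `|` F2)%fset => F; rewrite fsubUset => /andP[/h1 {}h1 /h2 {}h2].
by rewrite big_split opprD addrACA (le_lt_trans (gaugeD hG GN _ _))//; lra.
Qed.

Lemma has_sumN f s : has_sum f s -> has_sum (fun l => - f l) (- s).
Proof.
move=> /has_sumP hs; apply/has_sumP => N GN e e0.
have [F h] := hs N GN e e0; exists F => F' /h.
by rewrite sumrN -opprD (gaugeN hG GN).
Qed.

Lemma has_sumB f g s t :
  has_sum f s -> has_sum g t -> has_sum (fun l => f l - g l) (s - t).
Proof. by move=> hf /has_sumN; exact: has_sumD. Qed.

Lemma has_sum_finsupp f F : (forall l, l \notin F -> f l = 0) ->
  has_sum f (\sum_(l <- F) f l).
Proof.
move=> fF; apply/has_sumP => N GN e e0; exists F => F' FF'.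
rewrite (big_fset_incl _ FF') ?subrr ?(gauge0 hG GN)// => l _; exact: fF.
Qed.

Lemma has_sum_big (I : choiceType) (F : {fset I}) (f : I -> L -> V) (s : I -> V) :
  (forall i, has_sum (f i) (s i)) ->
  has_sum (fun l => \sum_(i <- F) f i l) (\sum_(i <- F) s i).
Proof.
move=> hf; elim: {F}(enum_fset F) => [|i r IH].
  have -> : (fun l => \sum_(i <- [::]) f i l) = fun=> 0 by apply/funext => l; rewrite big_nil.
  have := @has_sum_finsupp (fun=> 0) fset0 (fun _ _ => erefl).
  by rewrite big_seq_fset0 big_nil.
have -> : (fun l => \sum_(i <- i :: r) f i l) = (fun l => f i l + \sum_(i <- r) f i l).
  by apply/funext => l; rewrite big_cons.
by rewrite big_cons; apply: has_sumD.
Qed.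

Lemma has_sum_le f s N e : G N -> 0 < e -> has_sum f s ->
  (forall F, N (\sum_(l <- F) f l) <= e) -> N s <= 12 * e.
Proof.
move=> GN e0 /has_sumP hs h.
have [F /(_ F (fsubset_refl _)) hF] := hs N GN e e0.
have := gaugeB GN (\sum_(l <- F) f l) (\sum_(l <- F) f l - s).
by rewrite opprB addrC subrK; have := h F; lra.
Qed.

End OneIndex.

Lemma mem_fset_preimage (T L : choiceType) (h : T -> L) (F : {fset L}) j :
  injective h -> (j \in fset_set (h @^-1` [set` F])) = (h j \in F).
Proof.
move=> hinj; rewrite in_fset_set; last first.
  by apply: finite_preimage => // x y _ _; exact: hinj.
by apply/idP/idP => [/set_mem//|hj]; apply/mem_set.
Qed.

Lemma sum_image (T L : choiceType) (h : T -> L) (f : L -> V) (F : {fset T}) :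
  injective h ->
  \sum_(l <- [fset h j | j in F]%fset) f l = \sum_(j <- F) f (h j).
Proof. by move=> hinj; rewrite big_imfset//= => x y _ _ /hinj. Qed.

Lemma sum_preimage (T L : choiceType) (h : T -> L) (f : L -> V) (F : {fset L}) :
  injective h -> (forall l, l \in F -> ~ range h l -> f l = 0) ->
  \sum_(l <- F) f l = \sum_(j <- fset_set (h @^-1` [set` F])) f (h j).
Proof.
move=> hinj hf; rewrite -(sum_image f _ hinj).
apply/esym; apply: big_fset_incl => [|l lF].
  by apply/fsubsetP => _ /imfsetP[j /= + ->]; rewrite mem_fset_preimage.
move=> /imfsetP lh; apply: hf => // -[j _ jl]; apply: lh; exists j => //=.
by rewrite mem_fset_preimage// jl.
Qed.

Lemma has_sum_reindex (T L : choiceType) (h : T -> L) (f : L -> V) s :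
  injective h -> (forall l, ~ range h l -> f l = 0) ->
  has_sum f s <-> has_sum (fun j => f (h j)) s.
Proof.
move=> hinj hf; rewrite !has_sumP; split=> hs N GN e e0.
  have [F0 h0] := hs N GN e e0.
  exists (fset_set (h @^-1` [set` F0])) => F F0F.
  have := h0 (F0 `|` [fset h j | j in F])%fset (fsubsetUl _ _).
  rewrite (sum_preimage hinj) => [|l _]; last exact: hf.
  congr (N (_ - _) < e); apply: eq_fbigl => j.
  rewrite mem_fset_preimage// inE; apply/orP/idP => [[jF0|/imfsetP[k kF /hinj ->]//]|jF].
    by apply: (fsubsetP F0F); rewrite mem_fset_preimage.
  by right; apply/imfsetP; exists j.
have [F0 h0] := hs N GN e e0; exists [fset h j | j in F0]%fset => F F0F.
rewrite (sum_preimage hinj) => [|l _]; last exact: hf.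
apply: h0; apply/fsubsetP => j jF0; rewrite mem_fset_preimage//.
by apply: (fsubsetP F0F); apply/imfsetP; exists j.
Qed.

(** * Regrouping sums over a disjoint union *)

Section Sigma.
Context (I : choiceType) (J : I -> choiceType).
Local Notation L := {i : I & J i}.
Implicit Type f : L -> V.

Definition fibre i (j : J i) : L := Tagged J j.

Lemma fibre_inj i : injective (@fibre i).
Proof. by move=> j k /eqP; rewrite /fibre eq_Tagged /= => /eqP. Qed.

Lemma range_fibre i (l : L) : tag l = i -> range (@fibre i) l.
Proof. by move=> <-; exists (tagged l) => //; case: l. Qed.

(** Extension by zero keeps one index type, so that partial families can be added and subtracted
    termwise. *)
Definition restrict (P : pred I) f (l : L) := if P (tag l) then f l else 0.

Lemma sum_restrict P f (F : {fset L}) :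
  \sum_(l <- F) restrict P f l = \sum_(l <- [fset l in F | P (tag l)]%fset) f l.
Proof. by rewrite -big_fset_condE [RHS]big_mkcond. Qed.

Lemma has_sum_fibre f i s :
  has_sum (fun j : J i => f (fibre j)) s <-> has_sum (restrict (pred1 i) f) s.
Proof.
have fr l : ~ range (@fibre i) l -> restrict (pred1 i) f l = 0.
  by rewrite /restrict /=; case: eqP => // li []; exact: range_fibre.
have [h1 h2] := has_sum_reindex s (@fibre_inj i) fr.
have e : (fun j => restrict (pred1 i) f (fibre j)) = fun j : J i => f (fibre j).
  by apply/funext => j; rewrite /restrict /= eqxx.
by split=> [|/h1]; rewrite -e.
Qed.

Lemma has_sum_restrict f t (F : {fset I}) :
  (forall i, has_sum (fun j : J i => f (fibre j)) (t i)) ->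
  has_sum (restrict [in F] f) (\sum_(i <- F) t i).
Proof.
move=> ht; have := has_sum_big (F := F) (fun i => (has_sum_fibre f i (t i)).1 (ht i)).
congr (has_sum _ _); apply/funext => l; rewrite /restrict.
case: ifPn => [lF|lF].
  rewrite (big_fsetD1 (tag l))//= eqxx big1_fset ?addr0// => i.
  by rewrite !inE eq_sym => /andP[/negbTE ->].
by rewrite big1_fset// => i iF _; rewrite /= ifF//; apply: contraNF lF => /eqP ->.
Qed.

(** The error [s - \sum_(i <- F) t i] is the sum of [f] over the fibres outside [F]; once [F]
    contains the tags of [G0], every finite part of it avoids [G0]. *)
Lemma has_sum_sigma f s t :
  has_sum f s -> (forall i, has_sum (fun j : J i => f (fibre j)) (t i)) -> has_sum t s.
Proof.
move=> hs ht; apply/has_sumP => N GN e e0.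
have [|G0 hG0] := has_sum_cauchy hs GN (e := e / 24); first by rewrite divr_gt0.
exists [fset tag l | l in G0]%fset => F G0F.
rewrite -(gaugeN hG GN) opprB.
have : N (s - \sum_(i <- F) t i) <= 12 * (e / 24); last by lra.
apply: (has_sum_le GN _ (has_sumB hs (has_sum_restrict (F := F) ht))) => [|F']; first by rewrite divr_gt0.
rewrite (_ : \sum_(l <- F') _ = \sum_(l <- F') restrict [pred i | i \notin F] f l).
  rewrite sum_restrict ltW// hG0// => l; rewrite !inE => /andP[_].
  by apply: contra => lG0; apply: (fsubsetP G0F); apply/imfsetP; exists l.
apply: eq_bigr => l _; rewrite /restrict /=.
by case: ifP; rewrite ?subrr ?subr0.
Qed.

Lemma has_sum_finite_sigma f (F : {fset L}) :
  has_sum (fun i => \sum_(j <- fset_set (@fibre i @^-1` [set` F])) f (fibre j))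
    (\sum_(l <- F) f l).
Proof.
pose fF l := if l \in F then f l else 0.
have -> : \sum_(l <- F) f l = \sum_(l <- F) fF l.
  by rewrite [LHS]big_seq [RHS]big_seq; apply: eq_bigr => l lF; rewrite /fF lF.
have fF0 l : l \notin F -> fF l = 0 by rewrite /fF => /negbTE ->.
apply: (has_sum_sigma (has_sum_finsupp fF0)) => i.
set H := fset_set _.
have memH j : (j \in H) = (fibre j \in F) by exact/mem_fset_preimage/fibre_inj.
have -> : \sum_(j <- H) f (fibre j) = \sum_(j <- H) fF (fibre j).
  by rewrite [LHS]big_seq [RHS]big_seq; apply: eq_bigr => j; rewrite /fF memH => ->.
by apply: has_sum_finsupp => j; rewrite memH; exact: fF0.
Qed.

Lemma cauchy_sum_fibre f i : cauchy_sum f -> cauchy_sum (fun j : J i => f (fibre j)).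
Proof.
move=> hf N GN e e0; have [F0 h0] := hf N GN e e0.
exists (fset_set (@fibre i @^-1` [set` F0])) => F FF0.
rewrite -(sum_image f _ (@fibre_inj i)).
apply: h0 => _ /imfsetP[j /= jF ->]; have := FF0 _ jF; apply: contra => jF0.
by rewrite mem_fset_preimage//; exact: fibre_inj.
Qed.

(** Completeness yields some sum of [f]; regrouping and uniqueness identify it with [s]. *)
Lemma has_sum_sigma_cauchy f s t : cauchy_sum f ->
  (forall i, has_sum (fun j : J i => f (fibre j)) (t i)) -> has_sum t s -> has_sum f s.
Proof.
move=> /cauchy_has_sum[s' hs'] ht.
by move=> /(has_sum_unique (has_sum_sigma hs' ht)) <-.
Qed.

End Sigma.
End OneSpace.

Lemma has_sum_map (V W : PreUniformZmodule.type) (G : set (V -> R)) (H : set (W -> R))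
    (hG : gauged G) (hH : gauged H) (T : V -> W) (L : choiceType) (f : L -> V) s :
  {morph T : x y / x + y} ->
  (forall N, H N -> forall e, 0 < e -> exists N', G N' /\
    exists2 d, 0 < d & forall x, N' x < d -> N (T x) < e) ->
  has_sum f s -> has_sum (T \o f) (T s).
Proof.
move=> TD Tc /(has_sumP hG) hs; apply/(has_sumP hH) => N HN e e0.
have T0 : T 0 = 0 by apply: (@addrI _ (T 0)); rewrite -TD !addr0.
have TB x y : T (x - y) = T x - T y.
  by apply: (@addIr _ (T y)); rewrite -TD !subrK.
have [N' [GN' [d d0 hd]]] := Tc N HN e e0.
have [F0 h0] := hs N' GN' d d0; exists F0 => F /h0 /hd.
by rewrite TB (big_morph T TD T0).
Qed.

End GaugedSums.

(** * Gauges and inner products of Hilbert modules *)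

Section HilbertModules.
Import Order.TTheory GRing.Theory Num.Theory.
Local Open Scope complex_scope.
Local Open Scope classical_set_scope.
Local Open Scope ring_scope.
Context (R : realType) (A : proCStarType R).

Definition csn_gauges : set (A -> R) := [set p | continuous_cstar_seminorm p].

Lemma csn_gauged : gauged csn_gauges.
Proof.
split.
- by move=> p [hp _]; exact: csn_ge0.
- by move=> p [hp _]; exact: csn0.
- by move=> p [hp _]; exact: csnN.
- move=> p [hp _] x y; rewrite (le_trans (csnD hp _ _))//.
  by have := csn_ge0 hp x; have := csn_ge0 hp y; lra.
- move=> x hx; apply: procstar_hausdorff => U V xU V0; exists 0.
  split; last exact: nbhs_singleton.
  move: xU; rewrite -nbhs_entourageE => -[E /procstar_entourage[p [e [hp e0] hE]]].
  by apply; apply/mem_set; apply: hE; rewrite /= subr0 hx.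
- move=> E; rewrite procstar_entourage; split=> [[p [e [hp e0] hE]]|[p [e [hp e0 hE]]]].
    by exists p, e.
  by exists p, e.
- exact: procstar_complete.
Qed.

Section OneModule.
Context (X : hilbertModType A).
Implicit Types (x y z : X) (a b : A).

Lemma innerDr x y z : <| x, y + z |> = <| x, y |> + <| x, z |>.
Proof. by rewrite -inner_star innerDl starD !inner_star. Qed.

Lemma inner_actr a x y : <| x, a **: y |> = <| x, y |> * star a.
Proof. by rewrite -inner_star inner_act starM inner_star. Qed.

Lemma innerZr (k : R[i]) x y : <| x, k *: y |> = k^* *: <| x, y |>.
Proof. by rewrite -inner_star innerZl starZ inner_star. Qed.

Lemma inner0l y : <| 0, y |> = 0.
Proof. by apply: (@addrI _ <| 0, y |>); rewrite -innerDl !addr0. Qed.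

Lemma inner0r x : <| x, 0 |> = 0.
Proof. by apply: (@addrI _ <| x, 0 |>); rewrite -innerDr !addr0. Qed.

Lemma innerNl x y : <| - x, y |> = - <| x, y |>.
Proof. by apply: (@addrI _ <| x, y |>); rewrite -innerDl !subrr inner0l. Qed.

Lemma innerNr x y : <| x, - y |> = - <| x, y |>.
Proof. by apply: (@addrI _ <| x, y |>); rewrite -innerDr !subrr inner0r. Qed.

Lemma inner_suml (I : Type) (r : seq I) (f : I -> X) y :
  <| \sum_(i <- r) f i, y |> = \sum_(i <- r) <| f i, y |>.
Proof. exact: (big_morph (inner^~ y) (fun x x' => innerDl x x' y) (inner0l y)). Qed.

Lemma inner_sumr (I : Type) (r : seq I) (f : I -> X) x :
  <| x, \sum_(i <- r) f i |> = \sum_(i <- r) <| x, f i |>.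
Proof. exact: (big_morph (inner x) (innerDr x) (inner0r x)). Qed.

Lemma inner_ext x y : (forall z, <| x, z |> = <| y, z |>) -> x = y.
Proof.
move=> h; apply/eqP; rewrite -subr_eq0; apply/eqP/inner_eq0.
by rewrite innerDl innerNl h subrr.
Qed.

Lemma inner_positive x : positive <| x, x |>.
Proof. by have := inner_ge0 x; rewrite /ple subr0. Qed.

Section Gauge.
Context (p : A -> R) (hp : cstar_seminorm p).

Lemma csn_pos_inner x : csn_pos p <| x, x |>.
Proof. exact/positive_csn_pos/inner_positive. Qed.

(** Parallelogram identity: 6 is the 3 of [csn_le_add] times the 2 of the identity. *)
Lemma csn_inner_le_add x y :
  p <| x + y, x + y |> <= 6 * (p <| x, x |> + p <| y, y |>).
Proof.
have := csn_le_add hp (csn_pos_inner (x + y)) (csn_pos_inner (x - y)).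
have -> : <| x + y, x + y |> + <| x - y, x - y |> =
    (<| x, x |> + <| y, y |>) + (<| x, x |> + <| y, y |>).
  rewrite !(innerDl, innerDr) !(innerNl, innerNr) opprK.
  rewrite addrACA [X in X + _]addrACA subrr addr0.
  by rewrite [X in _ + X]addrACA subrr add0r addrACA.
have := csnD hp (<| x, x |> + <| y, y |>) (<| x, x |> + <| y, y |>).
have := csnD hp <| x, x |> <| y, y |>; lra.
Qed.

Lemma csn_inner_unitZ (k : R[i]) y : k * k^* = 1 ->
  p <| k *: y, k *: y |> = p <| y, y |>.
Proof. by move=> k1; rewrite innerZl innerZr scalerA k1 scale1r. Qed.

(** Polarization writes [4 <| x, y |>] with four squares [q k], each bounded by
    [csn_inner_le_add]. *)
Lemma csn_inner_le x y : p <| x, y |> <= 6 * (p <| x, x |> + p <| y, y |>).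
Proof.
set i : R[i] := 0 +i* 1.
have ic : i^* = - i by apply/eqP; rewrite eq_complex /= !oppr0 !eqxx.
have ii : i * i = -1 by apply/eqP; rewrite eq_complex /= ; apply/andP; split; apply/eqP; ring.
pose q k := <| x + k *: y, x + k *: y |>.
have qB k : q k - q (- k) = (k^* *: <| x, y |> + k *: <| y, x |>) *+ 2.
  have qE c : q c = <| x, x |> + c^* *: <| x, y |>
      + (c *: <| y, x |> + (c * c^*) *: <| y, y |>).
    by rewrite /q !(innerDl, innerDr) !(innerZl, innerZr) scalerA addrACA.
  rewrite !qE rmorphN mulrNN !scaleNr opprD addrACA opprB [_ + k^* *: _]addrC.
  rewrite [X in X + _]addrACA subrr addr0 opprD opprK [X in _ + X]addrACA subrr addr0.
  by rewrite addrACA mulr2n.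
have polar : <| x, y |> *+ 4 = q 1 - q (-1) + i *: (q i - q (- i)).
  rewrite !qB ic rmorph1 !scale1r -scalerMnr scalerDr !scalerA mulrN ii opprK.
  rewrite scale1r scaleN1r -mulrnDl addrACA subrr addr0 -mulr2n -mulrnA.
  by [].
have hq k : k * k^* = 1 -> p (q k) <= 6 * (p <| x, x |> + p <| y, y |>).
  by move=> k1; rewrite -(csn_inner_unitZ y k1) csn_inner_le_add.
have h1 := hq 1; rewrite rmorph1 mulr1 in h1.
have h2 := hq (-1); rewrite rmorphN rmorph1 mulrNN mulr1 in h2.
have h3 := hq i; rewrite ic mulrN ii opprK in h3.
have h4 := hq (- i); rewrite rmorphN /= ic mulrNN mulrN ii opprK in h4.
move: (h1 erefl) (h2 erefl) (h3 erefl) (h4 erefl) => {}h1 {}h2 {}h3 {}h4.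
have pi (z : A) : p (i *: z) = p z.
  apply: complexI; rewrite (csnZ hp) normc_def /= expr0n expr1n add0r sqrtr1.
  by rewrite mul1r.
have : 4 * p <| x, y |> <= p (q 1) + p (q (-1)) + (p (q i) + p (q (- i))).
  rewrite -csnZr// rmorph_nat scaler_nat polar (le_trans (csnD hp _ _))// pi.
  by rewrite lerD ?csnB.
lra.
Qed.

Lemma inner_continuous0 y e : 0 < e ->
  exists2 d, 0 < d & forall x, p <| x, x |> < d -> p <| x, y |> < e.
Proof.
move=> e0; have y0 := csn_ge0 hp <| y, y |>.
(* Replacing [x], [y] by [c x], [c^-1 y] preserves [<| x, y |>]. This [c] makes the [y] term at most
   [e / 24], and the radius chosen next does the same for the [x] term. *)
pose c := 1 + 24 * p <| y, y |> / e.
have c1 : 1 <= c by rewrite lerDl divr_ge0 ?mulr_ge0// ltW.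
have c0 : 0 < c by lra.
exists (e / (24 * c ^+ 2)); first by rewrite divr_gt0 ?mulr_gt0 ?exprn_gt0.
move=> x hx; have := csn_inner_le (c%:C *: x) ((c^-1)%:C *: y).
have cr (r : R) : (r%:C)^* = r%:C by rewrite conj_Creal ?complex_real.
rewrite !innerZl !innerZr !cr !scalerA -!rmorphM mulfV ?gt_eqF// scale1r.
rewrite !csnZr ?mulr_ge0 ?invr_ge0 ?(ltW c0)// => /le_lt_trans; apply.
move: hx; rewrite ltr_pdivlMr ?mulr_gt0 ?exprn_gt0// => hx.
have : c^-1 * c^-1 * p <| y, y |> <= e / 24.
  rewrite -invfM ler_pdivrMl ?mulr_gt0//.
  have : 24 * p <| y, y |> <= e * c.
    by rewrite /c mulrDr mulr1 [e * _]mulrC divfK ?gt_eqF//; lra.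
  have : e * c <= e * c * c by rewrite ler_peMr// mulr_ge0 ?ltW.
  nra.
rewrite mulrAC mulrC expr2 in hx *; nra.
Qed.

End Gauge.

(** Squares of the module seminorms, to which the parallelogram estimate applies directly; the
    uniformity is the same, with [e ^ 2] for [e]. *)
Definition inner_gauges : set (X -> R) :=
  [set N | exists2 p, continuous_cstar_seminorm p & N = fun x => p <| x, x |>].

Lemma inner_gauged : gauged inner_gauges.
Proof.
split.
- by move=> _ [p [hp _] ->] x; exact: csn_ge0.
- by move=> _ [p [hp _] ->]; rewrite inner0l csn0.
- by move=> _ [p [hp _] ->] x; rewrite innerNl innerNr opprK.
- by move=> _ [p [hp _] ->] x y; exact: csn_inner_le_add.
- move=> x hx; apply/inner_eq0/(gauge_eq0 csn_gauged) => p hp.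
  by apply: (hx (fun x => p <| x, x |>)); exists p.
- move=> E; rewrite hilbert_entourage; split.
    move=> [p [e [hp e0] hE]]; exists (fun x => p <| x, x |>), (e ^+ 2).
    split; [by exists p|exact: exprn_gt0|].
    apply: subset_trans hE => x /=; rewrite -ltr_sqrt ?exprn_gt0//.
    by rewrite sqrtr_sqr ger0_norm// ltW.
  move=> [_ [e [[p hp ->] e0 hE]]]; exists p, (Num.sqrt e).
    by rewrite sqrtr_gt0.
  by apply: subset_trans hE => x /=; rewrite ltr_sqrt.
- exact: hilbert_complete.
Qed.

Lemma has_sum_innerl (L : choiceType) (f : L -> X) s y :
  has_sum f s -> has_sum (fun l => <| f l, y |>) <| s, y |>.
Proof.
apply: (has_sum_map inner_gauged csn_gauged (T := inner^~ y)).
  by move=> x x'; exact: innerDl.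
move=> p hp e e0; exists (fun x => p <| x, x |>); split; first by exists p.
exact: inner_continuous0 hp.1 _ _ e0.
Qed.

(** * Expansions along an orthonormal family *)

Section Orthonormal.
Context (J : choiceType) (u : J -> X).
Hypothesis uon : forall j k, <| u j, u k |> = if j == k then 1 else 0.
Context (a : J -> A).

Lemma inner_orthonormal_sum (F : {fset J}) :
  <| \sum_(j <- F) a j **: u j, \sum_(j <- F) a j **: u j |> =
  \sum_(j <- F) a j * star (a j).
Proof.
rewrite inner_suml [LHS]big_seq [RHS]big_seq; apply: eq_bigr => j jF.
rewrite inner_sumr (big_fsetD1 j)//= big1_fset => [|k].
  by rewrite addr0 inner_act inner_actr uon eqxx mul1r.
rewrite !inE => /andP[/negbTE kj _] _.
by rewrite inner_act inner_actr uon eq_sym kj mul0r mulr0.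
Qed.

(** With [S] the finite sum, [<| x, S |>], [<| S, x |>] and [<| S, S |>] all coincide. Thus Parseval
    is equivalent to convergence of the expansion. *)
Lemma inner_orthonormal_rem x (F : {fset J}) : (forall j, <| x, u j |> = a j) ->
  <| x - \sum_(j <- F) a j **: u j, x - \sum_(j <- F) a j **: u j |> =
  <| x, x |> - \sum_(j <- F) a j * star (a j).
Proof.
move=> xa; rewrite innerDl !innerDr !innerNl !innerNr opprK inner_orthonormal_sum.
have xS : <| x, \sum_(j <- F) a j **: u j |> = \sum_(j <- F) a j * star (a j).
  by rewrite inner_sumr; apply: eq_bigr => j _; rewrite inner_actr xa.
have Sx : <| \sum_(j <- F) a j **: u j, x |> = \sum_(j <- F) a j * star (a j).
  by rewrite -inner_star xS raddf_sum /=; apply: eq_bigr => j _; rewrite starM starK.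
by rewrite xS Sx addNr addr0.
Qed.

Lemma has_sum_orthonormal_coef x k :
  has_sum (fun j => a j **: u j) x -> <| x, u k |> = a k.
Proof.
move=> /has_sum_innerl => /(_ (u k)) /(has_sum_unique csn_gauged); apply.
have := @has_sum_finsupp _ _ _ csn_gauged J (fun j => <| a j **: u j, u k |>) [fset k]%fset.
rewrite big_seq_fset1 inner_act uon eqxx mulr1; apply => j.
by rewrite inE => /negbTE jk; rewrite inner_act uon jk mulr0.
Qed.

Lemma has_sum_orthonormal x : (forall j, <| x, u j |> = a j) ->
  has_sum (fun j => a j * star (a j)) <| x, x |> -> has_sum (fun j => a j **: u j) x.
Proof.
move=> xa /(has_sumP csn_gauged) h; apply/(has_sumP inner_gauged) => _ [p hp ->] e e0.
have [F0 h0] := h p hp e e0; exists F0 => F /h0.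
rewrite -(opprB x) innerNl innerNr opprK inner_orthonormal_rem//.
by rewrite -(csnN hp.1) opprB.
Qed.

(** Riesz-Fischer: by Pythagoras the two Cauchy conditions are the same. *)
Lemma cauchy_sum_orthonormal : cauchy_sum csn_gauges (fun j => a j * star (a j)) ->
  exists x, has_sum (fun j => a j **: u j) x.
Proof.
move=> h; apply: (cauchy_has_sum inner_gauged) => _ [p hp ->] e e0.
have [F0 h0] := h p hp e e0; exists F0 => F /h0.
by rewrite inner_orthonormal_sum.
Qed.

End Orthonormal.

End OneModule.

(** * Adjoints and sums *)

Section Adjoint.
Context (X Y : hilbertModType A) (T : adjointable X Y).

Lemma inner_adjoint x y : <| adjoint T y, x |> = <| y, T x |>.
Proof. by rewrite -inner_star -adjointP inner_star. Qed.

Lemma adjointD y z : adjoint T (y + z) = adjoint T y + adjoint T z.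
Proof. by apply: inner_ext => x; rewrite innerDl !inner_adjoint innerDl. Qed.

Lemma adjoint0 : adjoint T 0 = 0.
Proof. by apply: inner_ext => x; rewrite inner_adjoint !inner0l. Qed.

Lemma adjoint_act a y : adjoint T (a **: y) = a **: adjoint T y.
Proof. by apply: inner_ext => x; rewrite inner_act !inner_adjoint inner_act. Qed.

(** Paired with any [z], both families become [<| f l, T z |>], whose sum is unique. *)
Lemma adjoint_has_sum (L : choiceType) (f : L -> Y) y x :
  has_sum f y -> has_sum (fun l => adjoint T (f l)) x -> x = adjoint T y.
Proof.
move=> hy hx; apply: inner_ext => z; rewrite inner_adjoint.
apply: (has_sum_unique csn_gauged (has_sum_innerl (y := z) hx)).
have := has_sum_innerl (y := T z) hy; congr (has_sum _ _).
by apply/funext => l; rewrite inner_adjoint.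
Qed.

End Adjoint.

(** * A Cauchy criterion for positive families over a disjoint union *)

Section PositiveSums.
Context (I : choiceType) (J : I -> choiceType) (f : {i : I & J i} -> A) (t : I -> A) (s : A).
Hypothesis f_pos : forall p, cstar_seminorm p -> forall l, csn_pos p (f l).
Hypothesis rem_pos : forall p, cstar_seminorm p -> forall i (F : {fset J i}),
  csn_pos p (t i - \sum_(j <- F) f (fibre j)).
Hypothesis fibre_sum : forall i, has_sum (fun j : J i => f (fibre j)) (t i).
Hypothesis total_sum : has_sum t s.

(** On the finitely many fibres over [T0] the family is summable; elsewhere its finite sums are
    dominated by tails of [t]. *)
Lemma cauchy_sum_positive : cauchy_sum csn_gauges f.
Proof.
move=> p hp e e0.
(* The factor 3 of [csn_le_add] turns [e / 6] into [e / 2]. *)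
have [|T0 hT0] := has_sum_cauchy csn_gauged total_sum hp (e := e / 6); first by rewrite divr_gt0.
have hr := has_sum_restrict csn_gauged (F := T0) fibre_sum.
have [|F0 hF0] := has_sum_cauchy csn_gauged hr hp (e := e / 2); first by rewrite divr_gt0.
exists F0 => F FF0.
have -> : \sum_(l <- F) f l = \sum_(l <- F) restrict [in T0] f l
    + \sum_(l <- F) restrict [pred i | i \notin T0] f l.
  rewrite -big_split; apply: eq_bigr => l _; rewrite /restrict /=.
  by case: ifP => _; rewrite ?addr0 ?add0r.
apply: (le_lt_trans (csnD hp.1 _ _)); rewrite [X in _ + p X]sum_restrict.
set F' := [fset l in F | _]%fset.
pose T := [fset tag l | l in F']%fset.
have partE : \sum_(l <- F') f l =
    \sum_(i <- T) \sum_(j <- fset_set (@fibre I J i @^-1` [set` F'])) f (fibre j).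
  rewrite (partition_big_imfset _ (fun l : {i : I & J i} => tag l)) /=.
  apply: eq_bigr => i _; rewrite big_mkcond /=.
  have fr l : l \in F' -> ~ range (@fibre I J i) l -> restrict (pred1 i) f l = 0.
    by move=> _; rewrite /restrict /=; case: eqP => // li []; exact: range_fibre.
  rewrite -/(restrict (pred1 i) f) (sum_preimage (@fibre_inj I J i) fr).
  by apply: eq_bigr => j _; rewrite /restrict /= eqxx.
have : p (\sum_(l <- F') f l) <= 3 * p (\sum_(i <- T) t i).
  rewrite -[\sum_(i <- T) t i](subrK (\sum_(l <- F') f l)) [_ - _ + _]addrC.
  apply: (csn_le_add hp.1); first by apply: (csn_pos_sum hp.1) => l _; exact: f_pos hp.1 _.
  by rewrite partE -sumrB; apply: (csn_pos_sum hp.1) => i _; exact: rem_pos hp.1 _ _.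
have : p (\sum_(i <- T) t i) < e / 6.
  by apply: hT0 => _ /imfsetP[l /= + ->]; rewrite !inE => /andP[].
have := hF0 F FF0; lra.
Qed.

End PositiveSums.

(** * Equivalence of the two Riesz basis conditions *)

Section MainEquivalence.
Context (X : hilbertModType A) (I : countType) (X_ : I -> hilbertModType A).
Context (K : adjointable X X) (Gamma : forall i, adjointable X (X_ i)).
Context (J : I -> countType) (u : forall i, J i -> X_ i).
Arguments u : clear implicits.
Hypothesis hu : forall i, standard_orthonormal_basis (u i).
Local Notation L := {i : I & J i}.

Definition frame_vector (l : L) : X := adjoint (Gamma (tag l)) (u (tag l) (tagged l)).

Lemma onb_coef_sum i (y : X_ i) :
  has_sum (fun j => <| y, u i j |> * star <| y, u i j |>) <| y, y |>.
Proof.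
have := (hu i).2 y; congr (has_sum _ _).
by apply/funext => j; rewrite inner_star.
Qed.

Lemma onb_expansion i (y : X_ i) : has_sum (fun j => <| y, u i j |> **: u i j) y.
Proof.
have := @has_sum_orthonormal _ _ _ (hu i).1 (fun j => <| y, u i j |>) y (fun=> erefl).
by apply; exact: onb_coef_sum.
Qed.

(** The products [<| x, frame_vector l |>] are the coefficients of [Gamma i x], and Parseval makes a
    vector vanish with its coefficients. *)
Lemma kernel_conditionE :
  [set x | forall i, Gamma i x = 0] = [set x | forall l, <| x, frame_vector l |> = 0].
Proof.
apply/seteqP; split=> x /= hx.
  by move=> l; rewrite -adjointP hx inner0l.
move=> i; apply/inner_eq0.
have e : (fun j => <| Gamma i x, u i j |> * star <| Gamma i x, u i j |>) = fun=> 0.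
  by apply/funext => j; rewrite adjointP (hx (fibre j)) mul0r.
have hs := onb_coef_sum (y := Gamma i x); rewrite e in hs.
have := @has_sum_finsupp _ _ _ csn_gauged (J i) (fun=> 0) fset0 (fun _ _ => erefl).
by rewrite big_seq_fset0 => /(has_sum_unique csn_gauged hs).
Qed.

(** The Cauchy hypothesis makes each fibre summable, and [adjoint_has_sum] identifies the fibre sum
    as [adjoint (Gamma i) (g i)]. *)
Lemma has_sum_frame_vector (a : L -> A) (g : forall i, X_ i) s :
  (forall i, has_sum (fun j => a (fibre j) **: u i j) (g i)) ->
  cauchy_sum (@inner_gauges X) (fun l => a l **: frame_vector l) ->
  has_sum (fun i => adjoint (Gamma i) (g i)) s <->
  has_sum (fun l => a l **: frame_vector l) s.
Proof.
move=> hg ha; have hf i : has_sum (fun j : J i => a (fibre j) **: frame_vector (fibre j))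
    (adjoint (Gamma i) (g i)).
  have [x hx] := cauchy_has_sum (inner_gauged X) (cauchy_sum_fibre i ha).
  rewrite -(@adjoint_has_sum _ _ (Gamma i) _ _ _ x (hg i))//.
  move: hx; congr (has_sum _ _); apply/funext => j.
  by rewrite adjoint_act.
split=> hs; first exact: (has_sum_sigma_cauchy (inner_gauged X) ha hf hs).
exact: (has_sum_sigma (inner_gauged X) hs hf).
Qed.

Lemma K_Riesz_of_K_g_Riesz : K_g_Riesz_basis K Gamma -> K_Riesz_basis K frame_vector.
Proof.
rewrite /K_g_Riesz_basis kernel_conditionE => -[hK [C [D [C0 D0 h]]]].
split=> //; exists C, D; split=> // a [t at_].
have ac := has_sum_cauchy csn_gauged at_.
have gP i : {y : X_ i | has_sum (fun j => a (fibre j) **: u i j) y}.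
  exact/cid/(cauchy_sum_orthonormal (hu i).1)/(cauchy_sum_fibre i ac).
pose g i := projT1 (gP i); have hg i := projT2 (gP i).
have hgg : has_sum (fun i => <| g i, g i |>) t.
  apply: (has_sum_sigma csn_gauged at_) => i.
  have := onb_coef_sum (y := g i); congr (has_sum _ _); apply/funext => j.
  by rewrite (has_sum_orthonormal_coef (hu i).1 j (hg i)).
(* The upper Riesz bound, applied to the finitely supported [gF], controls each finite sum;
   [e / (3 * D)] absorbs [D] and the 3 of [ple_csn_le]. *)
have sc : cauchy_sum (@inner_gauges X) (fun l => a l **: frame_vector l).
  move=> _ [p hp ->] e e0.
  have [|F0 hF0] := ac p hp (e / (3 * D)); first by rewrite divr_gt0 ?mulr_gt0.
  exists F0 => F /hF0 hF.
  pose gF i := \sum_(j <- fset_set (@fibre I J i @^-1` [set` F])) a (fibre j) **: u i j.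
  have hgF : has_sum (fun i => <| gF i, gF i |>) (\sum_(l <- F) a l * star (a l)).
    have := has_sum_finite_sigma csn_gauged (f := fun l => a l * star (a l)) (F := F).
    congr (has_sum _ _); apply/funext => i.
    by rewrite /gF (inner_orthonormal_sum (hu i).1).
  have [t' [s' [ht' hs' _]]] := h gF (ex_intro _ _ hgF).
  rewrite -(has_sum_unique csn_gauged hgF ht').
  have -> : s' = \sum_(l <- F) a l **: frame_vector l.
    apply: (has_sum_unique (inner_gauged X) hs').
    have := has_sum_finite_sigma (inner_gauged X) (f := fun l => a l **: frame_vector l) (F := F).
    congr (has_sum _ _); apply/funext => i; rewrite /gF.
    rewrite (big_morph _ (adjointD (Gamma i)) (adjoint0 (Gamma i))).
    by apply: eq_bigr => j _; rewrite adjoint_act.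
  move=> /(ple_csn_le hp.1 (inner_positive _)) /le_lt_trans; apply.
  rewrite (csnZr hp.1 _ (ltW D0)) mulrA mulrC.
  by rewrite -ltr_pdivlMr ?mulr_gt0.
have [t' [s [ht' hs Cs Ds]]] := h g (ex_intro _ _ hgg).
exists t', s; split=> //; last exact/(has_sum_frame_vector _ hg sc).
by rewrite -(has_sum_unique csn_gauged hgg ht').
Qed.

Lemma K_g_Riesz_of_K_Riesz : K_Riesz_basis K frame_vector -> K_g_Riesz_basis K Gamma.
Proof.
rewrite /K_g_Riesz_basis kernel_conditionE => -[hK [C [D [C0 D0 h]]]].
split=> //; exists C, D; split=> // g [t gt].
pose a (l : L) := <| g (tag l), u (tag l) (tagged l) |>.
have fa i : has_sum (fun j : J i => a (fibre j) * star (a (fibre j))) <| g i, g i |>.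
  exact: onb_coef_sum.
have ac : cauchy_sum (@csn_gauges) (fun l => a l * star (a l)).
  (* Terms and remainders are positive as inner squares: of [a l **: u (tag l) (tagged l)], and of
     [g i] minus its partial expansion. *)
  apply: (cauchy_sum_positive _ _ fa gt) => p hp => [l|i F].
    have := csn_pos_inner hp (a l **: u (tag l) (tagged l)).
    by rewrite inner_act inner_actr (hu _).1 eqxx mul1r.
  by rewrite -(inner_orthonormal_rem (hu i).1 F (fun=> erefl)); exact: csn_pos_inner.
have at_ : has_sum (fun l => a l * star (a l)) t.
  exact: (has_sum_sigma_cauchy csn_gauged ac fa gt).
have [t' [s [ht' hs Cs Ds]]] := h a (ex_intro _ _ at_).
exists t, s; rewrite (has_sum_unique csn_gauged at_ ht') in gt *; split=> //.
(* In this direction the Riesz condition itself supplies convergence over [L], hence the Cauchy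
   property. *)
have sc := has_sum_cauchy (inner_gauged X) hs.
exact/(has_sum_frame_vector s (fun i => onb_expansion (y := g i)) sc).
Qed.

End MainEquivalence.

End HilbertModules.

Theorem theorem3p9 (R : realType) (A : proCStarType R) (X : hilbertModType A)
  (I : countType) (X_ : I -> hilbertModType A) (K : adjointable X X)
  (Gamma : forall i : I, adjointable X (X_ i))
  (J : I -> set int) (u : forall i : I, J i -> X_ i)
  (hu : forall i : I, standard_orthonormal_basis (u i)) :
  K_g_Riesz_basis K Gamma <->
  K_Riesz_basis K
    (fun l : {i : I & J i} => adjoint (Gamma (tag l)) (u (tag l) (tagged l))).
Proof.
split; first exact: (K_Riesz_of_K_g_Riesz (J := fun i => set_type (J i)) hu).
exact: (K_g_Riesz_of_K_Riesz (J := fun i => set_type (J i)) hu).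
Qed.
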